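(* Let $t\ge 2$ be an integer. There exists a positive real $c_1=c_1(t)$ such that the following holds: if $G$ is a $3$-graph that does not contain $M^3_t$ as a subgraph, $G$ has no isolated vertex, and $G\neq K^3_{3t-1}$, then $$\lambda(G)\le \lambda(K^3_{3t-1})-c_1=\frac{1}{6}\left(\frac{[3t-1]_3}{(3t-1)^3}-6c_1\right).$$
   Context: An $r$-graph $G$ is a set $V(G)$ of vertices together with a set of $r$-element subsets of $V(G)$ (edges); $H$ is a subgraph of $G$ if $V(H)\subseteq V(G)$ and $E(H)\subseteq E(G)$. $K^r_p$ is the complete $r$-graph on $p$ vertices. $M^r_t$ denotes the $r$-graph consisting of $t$ pairwise disjoint edges. For an $r$-graph $G$ on $[n]$ and $\vec x\in[0,\infty)^n$, $\lambda(G,\vec x)=\sum_{e\in E(G)}\prod_{i\in e}x_i$, and the Lagrangian is $\lambda(G)=\max\{\lambda(G,\vec x):\vec x\in[0,\infty)^n,\ \sum_i x_i=1\}$. For positive integers $m,r$, $[m]_r=m(m-1)\cdots(m-r+1)$. *)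

(* Defs.v *)
From HB Require Import structures.
From mathcomp Require Import all_boot all_order all_algebra.
From mathcomp Require Import all_classical all_reals all_analysis.

Set Implicit Arguments.
Unset Strict Implicit.
Unset Printing Implicit Defensive.

Import Order.TTheory GRing.Theory Num.Theory.
Import numFieldNormedType.Exports.

Local Open Scope ring_scope.

Record r_graph (r : nat) := RGraph {
  vertex : finType;
  edges : {set {set vertex}};
  edges_card : forall e, e \in edges -> #|e| = r
}.

Definition isolated_vertex (r : nat) (G : r_graph r) (v : vertex G) : Prop :=
  forall e, e \in edges G -> v \notin e.

(* [G] has a subgraph isomorphic to [H]. *)
Definition contains_copy (r : nat) (G H : r_graph r) : Prop :=
  exists f : vertex H -> vertex G,
    injective f /\ (forall e, e \in edges H -> (f @: e)%SET \in edges G).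

Definition rgraph_iso (r : nat) (G H : r_graph r) : Prop :=
  exists f : vertex G -> vertex H,
    bijective f /\
    (forall e, (e \in edges G) = ((f @: e)%SET \in edges H)).

Definition complete_edges (r p : nat) : {set {set 'I_p}} :=
  [set e : {set 'I_p} | #|e| == r]%SET.

Lemma complete_edges_card (r p : nat) (e : {set 'I_p}) :
  e \in complete_edges r p -> #|e| = r.
Proof. by rewrite inE => /eqP. Qed.

Definition complete_rgraph (r p : nat) : r_graph r :=
  RGraph (@complete_edges_card r p).

Definition matching_edges (r t : nat) : {set {set 'I_t * 'I_r}} :=
  [set [set (i, j) | j in 'I_r] | i in 'I_t]%SET.

Lemma matching_edges_card (r t : nat) (e : {set 'I_t * 'I_r}) :
  e \in matching_edges r t -> #|e| = r.
Proof.
case/imsetP => i _ ->; rewrite card_imset; last by move=> j k [].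
by rewrite card_ord.
Qed.

Definition matching_rgraph (r t : nat) : r_graph r :=
  RGraph (@matching_edges_card r t).

Definition lagrange_poly (R : realType) (r : nat) (G : r_graph r)
    (x : vertex G -> R) : R :=
  \sum_(e in edges G) \prod_(i in e) x i.

Arguments lagrange_poly {R r} G x.

Local Open Scope classical_set_scope.

Definition simplex (R : realType) (V : finType) : set (V -> R) :=
  [set x | (forall i, 0 <= x i) /\ \sum_i x i = 1].

(* The supremum is a maximum whenever [G] has a vertex, see [lagrangian_max];
   it is [0] when [G] has none. *)
Definition lagrangian (R : realType) (r : nat) (G : r_graph r) : R :=
  sup [set lagrange_poly G x | x in @simplex R (vertex G)].

Lemma continuous_bigop (T U : topologicalType) (op : U -> U -> U) (idx : U)
    (I : finType) (P : pred I) (F : I -> T -> U) :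
  (forall f g : T -> U, continuous f -> continuous g ->
    continuous (fun x => op (f x) (g x))) ->
  (forall i, continuous (F i)) ->
  continuous (fun x => \big[op/idx]_(i | P i) F i x).
Proof.
move=> opc Fc; elim: (index_enum I) => [|i s IH].
  have -> : (fun x : T => \big[op/idx]_(i <- [::] | P i) F i x) = fun=> idx.
    by apply/funext => x; rewrite big_nil.
  exact: cst_continuous.
have -> : (fun x : T => \big[op/idx]_(i <- i :: s | P i) F i x) =
    if P i then fun x => op (F i x) (\big[op/idx]_(i <- s | P i) F i x)
    else fun x => \big[op/idx]_(i <- s | P i) F i x.
  by case: ifP => Pi; apply/funext => x; rewrite big_cons Pi.
by case: (P i) => //; apply: opc.
Qed.

Lemma continuous_bigsum (T : topologicalType) (R : realType)
    (I : finType) (P : pred I) (F : I -> T -> R) :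
  (forall i, continuous (F i)) -> continuous (fun x => \sum_(i | P i) F i x).
Proof.
by apply: continuous_bigop => f g fc gc x; apply: cvgD; [exact: fc|exact: gc].
Qed.

Lemma continuous_bigprod (T : topologicalType) (R : realType)
    (I : finType) (P : pred I) (F : I -> T -> R) :
  (forall i, continuous (F i)) -> continuous (fun x => \prod_(i | P i) F i x).
Proof.
by apply: continuous_bigop => f g fc gc x; apply: cvgM; [exact: fc|exact: gc].
Qed.

Lemma closed_level (T : topologicalType) (R : realType) (f : T -> R) (a : R) :
  continuous f -> closed (f @^-1` [set a]).
Proof.
move=> fc; apply: preimage_closed; last exact: closed_eq.
by move=> x _; exact: fc.
Qed.

Lemma compact_max_sup (T : topologicalType) (R : realType) (f : T -> R)
    (A : set T) :
  A !=set0 -> compact A -> continuous f ->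
  exists2 x, A x & f x = sup (f @` A) /\ forall y, A y -> f y <= f x.
Proof.
move=> A0 cA fc.
have [x /set_mem Ax xmax] := compact_EVT_max A0 cA (continuous_subspaceT fc).
have {}xmax y : A y -> f y <= f x by move=> Ay; apply: xmax; exact/mem_set.
exists x => //; split => //; apply/eqP; rewrite eq_le; apply/andP; split.
- apply: ub_le_sup; last by exists x.
  by exists (f x) => _ [y Ay <-]; exact: xmax.
- apply: ge_sup; first by exists (f x); exists x.
  by move=> _ [y Ay <-]; exact: xmax.
Qed.

Lemma lagrangian_max (R : realType) (r : nat) (G : r_graph r) (v : vertex G) :
  exists2 x : vertex G -> R, simplex x &
    lagrange_poly G x = lagrangian R G /\
    forall y, simplex y -> lagrange_poly G y <= lagrange_poly G x.
Proof.
set V := vertex G; set S := @simplex R V.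
pose T : topologicalType := prod_topology (fun _ : V => (R : topologicalType)).
have pc (i : V) : continuous (fun x : T => x i : R).
  exact: (@proj_continuous V (fun=> (R : topologicalType)) i).
have sumc : continuous (fun x : T => \sum_i x i : R).
  by apply: continuous_bigsum => i; exact: pc.
have polyc : continuous (fun x : T => lagrange_poly G (x : V -> R)).
  apply: continuous_bigsum => e.
  by apply: continuous_bigprod => i; exact: pc.
have S0 : S !=set0.
  exists (fun i => (i == v)%:R); split => [i|]; first exact: ler0n.
  by rewrite (bigD1 v) //= eqxx big1 ?addr0 // => i /negbTE ->.
have cS : @compact T S.
  have -> : S = [set x : T | forall i, `[0, 1]%classic (x i)] `&`
      ((fun x : T => \sum_i x i) @^-1` [set 1]).
    apply/seteqP; split => x /= [x0 x1].
    - split => // i; rewrite /= in_itv /= x0 /= -x1 (bigD1 i) //= lerDl.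
      by apply: sumr_ge0 => j _.
    - by split => // i; have := x0 i; rewrite /= in_itv /= => /andP[].
  apply: compact_closedI.
    apply: (@tychonoff V (fun=> (R : topologicalType)) (fun=> `[0, 1]%classic)).
    by move=> i; exact: segment_compact.
  exact: closed_level.
by have [x Sx xmax] := @compact_max_sup T R _ S S0 cS polyc; exists x.
Qed.

(* Main.v *)
(** Write [6 * lambda(K_p) = dens p] with [p = 3t - 1]. Let [x] be a weighting
    with support [T] of an [M_t]-free, [K_p]-free 3-graph. If two vertices of
    [T] lie in no common edge, all their weight can be moved to one of them. If
    [|T| <= p], a quantitative Maclaurin inequality gives the gap. Otherwise let
    [m] be a vertex of maximum weight. Compressing a vertex [c] towards [m]
    does not decrease the polynomial and creates no [M_t]; it creates no [K_p]
    either, because some edge contains both [m] and [c]. When no compression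
    towards [m] changes the graph, every triple of [T] through [m] is an edge,
    since all pairs are covered; hence the graph without [m] is
    [M_{t-1}]-free, and by induction on [t], with [a] the weight of [m],
    [6 * lambda <= 3 a (1 - a)^2 + dens (p - 3) (1 - a)^3], which is bounded
    away from [dens p].

    An [M_t]-free graph containing [K_p] has all its edges inside it, so without
    isolated vertices it is [K_p]. *)
Require Import Defs.
From mathcomp Require Import all_boot all_order all_algebra all_fingroup.
From mathcomp Require Import ring lra zify.
Import Order.TTheory GRing.Theory Num.Theory.
Set Implicit Arguments.
Unset Strict Implicit.
Unset Printing Implicit Defensive.
Local Open Scope set_scope.
Local Open Scope ring_scope.

(** * Matchings and complete subsystems of 3-uniform set systems *)

Section Matchings.
Variable V : finType.
Implicit Types (F M : {set {set V}}) (e A B K : {set V}).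

Definition uniform3 F := forall e, e \in F -> #|e| = 3%N.

Definition has_matching F t :=
  exists M, [/\ M \subset F, trivIset M & #|M| = t].

Definition contains_complete F p :=
  exists K, #|K| = p /\ forall e, e \subset K -> #|e| = 3%N -> e \in F.

Lemma has_matchingS F F' t :
  F \subset F' -> has_matching F t -> has_matching F' t.
Proof.
by move=> sF [M [sM tM cM]]; exists M; split=> //; apply: subset_trans sF.
Qed.

Lemma contains_completeS F F' p :
  F \subset F' -> contains_complete F p -> contains_complete F' p.
Proof.
move=> /subsetP sF [K [cK hK]]; exists K; split=> // e eK e3.
by apply: sF; apply: hK.
Qed.

Lemma subset_of_card A k :
  (k <= #|A|)%N -> exists2 B : {set V}, B \subset A & #|B| = k.
Proof.
case/card_geqP => s [us <- sA]; exists [set v in s].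
  by apply/subsetP => v; rewrite inE; apply: sA.
by rewrite cardsE; apply/card_uniqP.
Qed.

Lemma matchingU1 M e :
  uniform3 M -> trivIset M -> [disjoint e & cover M] ->
  trivIset (e |: M) /\ #|e |: M| = #|M|.+1.
Proof.
move=> uM tM dM.
have M0 : set0 \notin M by apply/negP => /uM; rewrite cards0.
have dis : {in M, forall B : {set V}, [disjoint e & B]}.
  move=> B BM; apply: disjointWr dM; apply/subsetP => v vB.
  by apply/bigcupP; exists B.
have [tU eM] := trivIsetU1 dis tM M0.
by rewrite cardsU1 eM.
Qed.

Lemma disjoint_sub_setD e A B : B \subset A :\: e -> [disjoint e & B].
Proof.
move=> BA; rewrite -setI_eq0; apply/eqP/setP => v; rewrite !inE.
by apply/negP => /andP[ve /(subsetP BA)]; rewrite inE ve.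
Qed.

Lemma complete_has_matching F A k :
  uniform3 F -> (forall e, e \subset A -> #|e| = 3%N -> e \in F) ->
  (3 * k <= #|A|)%N ->
  exists M, [/\ M \subset F, trivIset M, #|M| = k & cover M \subset A].
Proof.
move=> uF; elim: k A => [|k IH] A hA kA.
  exists set0; split; rewrite ?sub0set ?cards0 //; last first.
    by rewrite /cover big_set0 sub0set.
  by apply/trivIsetP => ? ?; rewrite inE.
have [|B BA B3] := @subset_of_card A 3; first by lia.
have [||M [sM tM cM MA]] := IH (A :\: B).
- by move=> e eA; apply: hA; apply: subset_trans eA _; apply: subsetDl.
- by have := cardsID B A; rewrite (setIidPr BA) B3; lia.
have uM : uniform3 M by move=> e /(subsetP sM)/uF.
have [tU cU] := matchingU1 uM tM (disjoint_sub_setD MA).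
exists (B |: M); split; rewrite ?cU ?cM //.
- by rewrite subUset sub1set sM hA.
- apply/bigcupsP => C; rewrite !inE => /orP[/eqP->//|CM].
  apply: subset_trans (subset_trans MA (subsetDl _ _)).
  exact: (bigcup_sup C).
Qed.

(** The part of [A] outside [e] holds [k] disjoint triples, all edges; [e] is one more. *)
Lemma complete_plus_edge F A e k :
  uniform3 F -> (forall e, e \subset A -> #|e| = 3%N -> e \in F) ->
  e \in F -> (3 * k <= #|A :\: e|)%N -> has_matching F k.+1.
Proof.
move=> uF hA eF kA.
have [|M [sM tM <- cM]] := @complete_has_matching F (A :\: e) k uF _ kA.
  by move=> e' e'A; apply: hA; apply: subset_trans e'A (subsetDl _ _).
have uM : uniform3 M by move=> e' /(subsetP sM)/uF.
have [tU cU] := matchingU1 uM tM (disjoint_sub_setD cM).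
by exists (e |: M); split=> //; rewrite subUset sub1set eF.
Qed.

(** An edge leaving [K] meets it in at most two vertices, so at least [3 * (t - 1)] vertices of [K]
    remain: enough for [t - 1] disjoint edges, which together with [e] form a matching of size
    [t]. *)
Lemma edge_sub_complete F K e t : (0 < t)%N ->
  uniform3 F -> ~ has_matching F t -> #|K| = (3 * t - 1)%N ->
  (forall e, e \subset K -> #|e| = 3%N -> e \in F) -> e \in F -> e \subset K.
Proof.
case: t => // t _ uF nM cK hK eF; apply/negPn/negP => eK; apply: nM.
apply: (complete_plus_edge uF hK eF).
have := cardsID e K; have := cardsID K e; rewrite (uF e) // (setIC e K) cK.
have : (0 < #|e :\: K|)%N by rewrite card_gt0 setD_eq0.
lia.
Qed.

(** * Compressions of set systems *)

Definition swap (i j : V) e := tperm i j @: e.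

Lemma swapK i j : involutive (swap i j).
Proof.
move=> e; rewrite /swap -imset_comp -[RHS]imset_id; apply: eq_imset => v.
by rewrite /= tpermK.
Qed.

Lemma swap_inj i j : injective (swap i j).
Proof. exact: inv_inj (swapK i j). Qed.

Lemma card_swap i j e : #|swap i j e| = #|e|.
Proof. by rewrite card_imset //; apply: perm_inj. Qed.

Lemma in_swap i j e v : (v \in swap i j e) = (tperm i j v \in e).
Proof. by rewrite -{1}[v](tpermK i j) mem_imset //; apply: perm_inj. Qed.

Lemma swap_id i j e : (i \in e) = (j \in e) -> swap i j e = e.
Proof.
move=> ij; apply/setP => v; rewrite in_swap.
by case: tpermP => // ->; rewrite ij.
Qed.

(* The compression replacing [j] by [i]: of the two edges [e], [swap i j e],
   the one through [i] takes precedence. *)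
Definition shift (i j : V) F : {set {set V}} :=
  [set e : {set V} |
    if (i \in e) && (j \notin e) then (e \in F) || (swap i j e \in F)
    else if (j \in e) && (i \notin e) then (e \in F) && (swap i j e \in F)
    else e \in F].

Lemma shift_cases i j F e : e \in shift i j F -> e \in F \/ swap i j e \in F.
Proof.
rewrite inE; case: ifP => _; first by move/orP.
by case: ifP => _; [case/andP; left|left].
Qed.

Lemma shift_uniform3 i j F : uniform3 F -> uniform3 (shift i j F).
Proof.
by move=> uF e /shift_cases[/uF//|/uF]; rewrite card_swap.
Qed.

Lemma shift_notin i j F e : i \notin e -> e \in shift i j F ->
  e \in F /\ swap i j e \in F.
Proof.
move=> ie; rewrite inE (negbTE ie) /= andbT; case: ifP => je.
  by case/andP.
by move=> eF; rewrite swap_id // (negbTE ie) je.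
Qed.

(** A new edge [e] of the matching contains [i], so the other edges avoid [i]. By [shift_notin]
    their swaps lie in [F], and so does the swap of [e]; swapping the whole matching therefore lands
    in [F]. *)
Lemma shift_matching i j F t :
  has_matching (shift i j F) t -> has_matching F t.
Proof.
case=> M [sM tM cM]; case: (boolP (M \subset F)) => [MF|]; first by exists M.
case/subsetPn => e eM eF.
have eS : e \in shift i j F := subsetP sM _ eM.
have seF : swap i j e \in F by case: (shift_cases eS) => //; rewrite (negbTE eF).
have ie : i \in e.
  by apply/negPn/negP => /shift_notin /(_ eS)[]; rewrite (negbTE eF).
exists (swap i j @: M); split.
- apply/subsetP => _ /imsetP[f fM ->].
  have [->//|fe] := eqVneq f e.
  have fi : i \notin f.
    rewrite eq_sym in fe.
    by rewrite (disjointFr (trivIsetP tM _ _ eM fM fe) ie).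
  by have [] := shift_notin fi (subsetP sM _ fM).
- apply/trivIsetP => _ _ /imsetP[f fM ->] /imsetP[g gM ->] fg.
  have nfg : f != g by apply: contraNneq fg => ->.
  have := trivIsetP tM _ _ fM gM nfg; rewrite -!setI_eq0 => /eqP d.
  by rewrite -imsetI ?d ?imset0 // => ? ? _ _; apply: perm_inj.
- by rewrite card_imset //; apply: swap_inj.
Qed.

(** The same set [K] works. Its triples avoiding [i] were already in [F]. If [j] is in [K], a triple
    with [i] but not [j] is the swap of a triple of [K] avoiding [i], hence also in [F]. *)
Lemma shift_complete i j F e0 t : (0 < t)%N ->
  uniform3 F -> ~ has_matching F t ->
  e0 \in F -> i \in e0 -> j \in e0 -> i != j ->
  contains_complete (shift i j F) (3 * t - 1) ->
  contains_complete F (3 * t - 1).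
Proof.
case: t => // t _ uF nM e0F ie0 je0 ij [K [cK hK]].
exists K; split=> // e eK e3.
have [ie|/shift_notin] := boolP (i \in e); last by case/(_ _ _ (hK _ eK e3)).
have iK : i \in K by apply: subsetP eK _ ie.
case: (boolP (j \in K)) => jK.
  have := hK _ eK e3; rewrite inE ie; case: ifP => /= [je|]; last by rewrite andbF.
  case/orP => // sF.
  have sK : swap i j e \subset K.
    apply/subsetP => v; rewrite in_swap; case: tpermP => [->//|->//|_ _].
    exact: subsetP eK _.
  have := hK _ sK; rewrite card_swap => /(_ e3) /shift_notin [].
    by rewrite in_swap tpermL.
  by rewrite swapK.
(* Now [j] is not in [K]. All triples of [K :\ i] are in [F], and [e0], which contains both [i] and
   [j], meets [K :\ i] in at most one vertex. This leaves three vertices for each of the remaining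
   matching edges. *)
exfalso; apply: nM.
apply: (@complete_plus_edge F (K :\ i) e0) => //.
  move=> e' e'K e'3.
  have [|//] := @shift_notin i j F e' _ (hK _ (subset_trans e'K (subsetDl _ _)) e'3).
  by apply/negP => /(subsetP e'K); rewrite !inE eqxx.
have := cardsID e0 (K :\ i); have := cardsD1 i K; rewrite iK cK.
have : (#|(K :\ i) :&: e0| <= #|e0 :\ i :\ j|)%N.
  apply/subset_leq_card/subsetP => v; rewrite !inE => /andP[/andP[-> vK] ->].
  by rewrite !andbT; apply: contraNneq jK => <-.
have := cardsD1 i e0; have := cardsD1 j (e0 :\ i).
rewrite (uF e0) // ie0 !inE eq_sym ij je0.
lia.
Qed.

End Matchings.

(** * The Lagrange polynomial as a sum over ordered triples *)

Section LagrangePolynomial.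
Variables (R : realFieldType) (V : finType).
Implicit Types (F : {set {set V}}) (e T : {set V}) (x y : V -> R).

Definition lam F x : R := \sum_(e in F) \prod_(v in e) x v.

Lemma sum_mem e : \sum_v (v \in e)%:R = #|e|%:R :> R.
Proof.
rewrite -sum1_card natr_sum [RHS]big_mkcond /=; apply: eq_bigr => v _.
by case: (v \in e).
Qed.

Lemma sum_delta (j : V) (f : V -> R) : \sum_k (j == k)%:R * f k = f j.
Proof.
rewrite (bigD1 j) //= eqxx mul1r big1 ?addr0 // => k kj.
by rewrite eq_sym (negbTE kj) mul0r.
Qed.

Lemma sum_support T (f : V -> R) : (forall v, v \notin T -> f v = 0) ->
  \sum_v f v = \sum_(v in T) f v.
Proof.
move=> fT; rewrite [RHS]big_mkcond; apply: eq_bigr => v _.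
by case: ifPn => // /fT.
Qed.

(** Each 3-set has six orderings; sums over ordered triples factor, unlike sums over edges. *)
Lemma prod_ordered e x : #|e| = 3%N ->
  6 * \prod_(v in e) x v =
  \sum_i \sum_j \sum_k ([set i; j; k] == e)%:R * (x i * x j * x k).
Proof.
move=> e3; set P := \prod_(v in e) x v.
have H i j : \sum_k ([set i; j; k] == e)%:R * (x i * x j * x k) =
    P * (i \in e)%:R * (j \in e :\ i)%:R.
  have [ie|ie] := boolP (i \in e); last first.
    rewrite big1 => [|k _]; first by rewrite mulr0 mul0r.
    case: eqP => [E|_]; last by rewrite mul0r.
    by rewrite -E !inE eqxx in ie.
  have [je|je] := boolP (j \in e :\ i); last first.
    rewrite big1 => [|k _]; first by rewrite mulr0.
    case: eqP => [E|]; rewrite ?mul0r //.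
    have ij : i = j.
      by apply/eqP; move: je; rewrite -E !inE eqxx orbT andbT negbK eq_sym.
    have : (#|[set i; j; k]| <= 2)%N.
      by rewrite ij setUid cards2; case: (_ != _).
    by rewrite E e3.
  have : #|e :\ i :\ j| == 1%N.
    have := cardsD1 i e; have := cardsD1 j (e :\ i).
    by rewrite e3 ie je; lia.
  case/cards1P => k0 Ek.
  have Ee : e = [set i; j; k0].
    by rewrite -(setD1K ie) -(setD1K je) Ek setUA.
  rewrite (bigD1 k0) //= big1 => [|k kk].
    rewrite -Ee eqxx /P (big_setD1 i) //= (big_setD1 j) //= Ek big_set1.
    by ring.
  case: eqP => [E|]; rewrite ?mul0r //.
  have : k0 \in [set i; j; k] by rewrite E Ee !inE eqxx orbT.
  have : k0 \in e :\ i :\ j by rewrite Ek set11.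
  rewrite !inE => /andP[/negbTE-> /andP[/negbTE-> _]] /=.
  by rewrite eq_sym (negbTE kk).
under eq_bigr => i _.
  under eq_bigr => j _ do rewrite H.
  rewrite -mulr_sumr sum_mem.
  have -> : P * (i \in e)%:R * #|e :\ i|%:R = 2 * P * (i \in e)%:R.
    have := cardsD1 i e; case: (i \in e); last by rewrite !mulr0 mul0r.
    by rewrite e3 add1n => -[<-]; ring.
  over.
by rewrite -mulr_sumr sum_mem e3; ring.
Qed.

Lemma lam_ordered F x : uniform3 F ->
  6 * lam F x =
  \sum_i \sum_j \sum_k ([set i; j; k] \in F)%:R * (x i * x j * x k).
Proof.
move=> uF; rewrite mulr_sumr.
under eq_bigr => e eF do rewrite (prod_ordered _ (uF _ eF)).
rewrite exchange_big; apply: eq_bigr => i _.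
rewrite exchange_big; apply: eq_bigr => j _.
rewrite exchange_big; apply: eq_bigr => k _ /=.
rewrite -mulr_suml; congr (_ * _).
have [SF|SF] := boolP (_ \in F).
  rewrite (bigD1 [set i; j; k]) //= eqxx big1 ?addr0 // => e /andP[_].
  by rewrite eq_sym => /negbTE ->.
by rewrite big1 // => e eF; case: eqP => // E; rewrite E eF in SF.
Qed.

(** * Power sums and Maclaurin-type bounds *)

Lemma edge_distinct F i j k : uniform3 F -> [set i; j; k] \in F ->
  [/\ i != j, j != k & i != k].
Proof.
move=> uF /uF c3; split; apply/eqP => E; move: c3; rewrite E.
- by rewrite setUid cards2; case: (_ != _).
- by rewrite -setUA setUid cards2; case: (_ != _).
- by rewrite setUC setUA setUid cards2; case: (_ != _).
Qed.

(** By Newton's identities the right-hand side is six times the third elementary symmetric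
    polynomial, to which all triples contribute. *)
Lemma lam_le_power_sums F x : uniform3 F -> (forall v, 0 <= x v) ->
  6 * lam F x <= (\sum_v x v) ^+ 3
                 - 3 * (\sum_v x v) * (\sum_v x v ^+ 2) + 2 * \sum_v x v ^+ 3.
Proof.
move=> uF x0; rewrite lam_ordered //.
set S := \sum_v x v; set P2 := \sum_v x v ^+ 2; set P3 := \sum_v x v ^+ 3.
(* [c] is the indicator of pairwise distinct indices, by inclusion-exclusion: any two of the
   equalities imply the third. *)
pose c (i j k : V) : R := 1 - (i == j)%:R - (j == k)%:R - (i == k)%:R
  + 2 * (i == j)%:R * (j == k)%:R.
have -> : S ^+ 3 - 3 * S * P2 + 2 * P3 =
    \sum_i \sum_j \sum_k c i j k * (x i * x j * x k).
  have Hk i j : \sum_k c i j k * (x i * x j * x k) =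
      x i * (S * x j) - x i * x j ^+ 2 - x i ^+ 2 * x j
      + (i == j)%:R * (2 * x i * x j ^+ 2 - x i * (S * x j)).
    transitivity (\sum_k (x i * x j * (1 - (i == j)%:R) * x k
       + (j == k)%:R * ((2 * (i == j)%:R - 1) * (x i * x j) * x k)
       + (i == k)%:R * (- (x i * x j) * x k))).
      by apply: eq_bigr => k _; rewrite /c; ring.
    rewrite !big_split /= -mulr_sumr !sum_delta -/S; ring.
  have Hj i : \sum_j \sum_k c i j k * (x i * x j * x k) =
      x i * (S * S) - x i * P2 - 2 * S * x i ^+ 2 + 2 * x i ^+ 3.
    under eq_bigr => j _ do rewrite Hk.
    rewrite !big_split /= sum_delta -!mulr_sumr !sumrN -!mulr_sumr -/S -/P2.
    ring.
  under [RHS]eq_bigr => i _ do rewrite Hj.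
  rewrite !big_split /= !sumrN -!mulr_suml -!mulr_sumr -/S -/P2 -/P3; ring.
apply: ler_sum => i _; apply: ler_sum => j _; apply: ler_sum => k _.
apply: ler_wpM2r; first by rewrite !mulr_ge0.
rewrite /c; have [/(edge_distinct uF)[]|_] := boolP (_ \in F).
  by move=> /negbTE-> /negbTE-> /negbTE-> /=; lra.
case: (eqVneq i j) => [->|ij]; first by case: (j == k) => /=; lra.
case: (eqVneq j k) => [<-|jk]; first by rewrite (negbTE ij) /=; lra.
by case: (i == k) => /=; lra.
Qed.

(** This is [(p - 1) * (p - 2) / p ^+ 2], that is, [[p]_3 / p^3]. The argument is a field element so
    that calculus-style estimates apply. *)
Definition dens (p : R) : R := 1 - 3 / p + 2 / p ^+ 2.

(** The excess of the sum of squares over its value at the uniform weighting of [p] vertices has two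
    sources: uneven weights on [T], and the vertices that [T] lacks. *)
Lemma variance_eq x T (p : nat) : (0 < p)%N ->
  (forall v, v \notin T -> x v = 0) -> \sum_v x v = 1 ->
  \sum_v x v ^+ 2 - p%:R^-1 =
  \sum_(v in T) (x v - p%:R^-1) ^+ 2 + (p%:R - #|T|%:R) / p%:R ^+ 2.
Proof.
move=> p0 xT x1.
have T1 : \sum_(v in T) x v = 1 by rewrite -sum_support.
have -> : \sum_v x v ^+ 2 = \sum_(v in T) x v ^+ 2.
  by apply: sum_support => v /xT ->; rewrite expr0n.
have -> : \sum_(v in T) (x v - p%:R^-1) ^+ 2 =
    \sum_(v in T) x v ^+ 2 - 2 / p%:R + #|T|%:R / p%:R ^+ 2.
  transitivity (\sum_(v in T) (x v ^+ 2 + (- (2 / p%:R)) * x v + p%:R^-1 ^+ 2)).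
    by apply: eq_bigr => v _; ring.
  rewrite !big_split /= -mulr_sumr T1 sumr_const -mulr_natl exprVn; ring.
have pn0 : p%:R != 0 :> R by rewrite pnatr_eq0; lia.
by field.
Qed.

(* A quantitative Maclaurin inequality: it expresses that
   [\sum_(v in T) (x v - 1/p)^2 (1 - x v)] is nonnegative. *)
Lemma lam_le_variance F x T (p : nat) : (0 < p)%N -> uniform3 F ->
  (forall v, 0 <= x v) -> (forall v, v \notin T -> x v = 0) ->
  \sum_v x v = 1 -> (#|T| <= p)%N ->
  6 * lam F x <= dens p%:R - (1 - 4 / p%:R) * (\sum_v x v ^+ 2 - p%:R^-1).
Proof.
move=> p0 uF x0 xT x1 Tp.
have := lam_le_power_sums uF x0; rewrite x1.
set P2 := \sum_v x v ^+ 2; set P3 := \sum_v x v ^+ 3 => H.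
have xle1 v : x v <= 1.
  by rewrite -x1 (bigD1 v) //= lerDl sumr_ge0.
have pn0 : p%:R != 0 :> R by rewrite pnatr_eq0; lia.
have : 0 <= \sum_(v in T) (x v - p%:R^-1) ^+ 2 * (1 - x v).
  by apply: sumr_ge0 => v _; rewrite mulr_ge0 ?sqr_ge0 ?subr_ge0.
have -> : \sum_(v in T) (x v - p%:R^-1) ^+ 2 * (1 - x v) =
    (1 + 2 / p%:R) * P2 - P3 - 2 / p%:R - p%:R^-1 ^+ 2 + #|T|%:R * p%:R^-1 ^+ 2.
  transitivity (\sum_(v in T) ((1 + 2 / p%:R) * x v ^+ 2 - x v ^+ 3
      + (- (2 / p%:R) - p%:R^-1 ^+ 2) * x v + p%:R^-1 ^+ 2)).
    by apply: eq_bigr => v _; ring.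
  rewrite !big_split /= sumrN -!mulr_sumr sumr_const -mulr_natl.
  rewrite -!sum_support ?x1; try by move=> v /xT ->; rewrite ?expr0n.
  by rewrite -/P2 -/P3; ring.
have : #|T|%:R * p%:R^-1 ^+ 2 <= p%:R * p%:R^-1 ^+ 2 :> R.
  by apply: ler_wpM2r; rewrite ?sqr_ge0 ?ler_nat.
have -> : p%:R * p%:R^-1 ^+ 2 = p%:R^-1 :> R by field.
rewrite /dens -exprVn; set q := p%:R^-1 => H1 H2; nra.
Qed.

Lemma lamU1 F x e : e \notin F -> lam (e |: F) x = \prod_(v in e) x v + lam F x.
Proof. by move=> eF; rewrite /lam big_setU1. Qed.

(** If [T] has fewer than [p] vertices, the missing ones force an excess in [variance_eq]. Otherwise
    some triple [e] of [T] is not an edge, and the bound of [lam_le_variance] holds even with [e]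
    added to [F]. *)
Lemma lam_small_gap F x T (p : nat) : (5 <= p)%N -> uniform3 F ->
  (forall v, 0 <= x v) -> (forall v, v \notin T -> x v = 0) ->
  \sum_v x v = 1 -> (#|T| <= p)%N -> ~ contains_complete F p ->
  6 * lam F x <= dens p%:R - (4 * p%:R ^+ 3)^-1.
Proof.
move=> p5 uF x0 xT x1 Tp nK.
have p0 : (0 < p)%N by lia.
have p5R : 5 <= p%:R :> R by rewrite (ler_nat R 5 p).
have pn0 : p%:R != 0 :> R by rewrite pnatr_eq0; lia.
have Vq := variance_eq p0 xT x1.
(* For [p] at least 5 the factor [1 - 4 / p] is at least [1 / p], so an excess of [1 / (4 p^2)]
   suffices for the gap. *)
have key (w : R) : (4 * p%:R ^+ 2)^-1 <= w ->
    (4 * p%:R ^+ 3)^-1 <= (1 - 4 / p%:R) * w.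
  move=> hw; have h : 0 <= 1 - 4 / p%:R :> R.
    by rewrite subr_ge0 ler_pdivrMr; lra.
  apply: le_trans (ler_wpM2l h hw).
  rewrite -subr_ge0.
  have -> : (1 - 4 / p%:R) / (4 * p%:R ^+ 2) - (4 * p%:R ^+ 3)^-1 =
     (p%:R - 5) / (4 * p%:R ^+ 3) :> R by field.
  by rewrite divr_ge0 ?mulr_ge0 ?exprn_ge0 ?subr_ge0 //; lra.
have [Tlt|Tge] := ltnP #|T| p.
  have := lam_le_variance p0 uF x0 xT x1 Tp.
  suff : (4 * p%:R ^+ 2)^-1 <= \sum_v x v ^+ 2 - p%:R^-1 by move/key; lra.
  rewrite Vq.
  have S0 : 0 <= \sum_(v in T) (x v - p%:R^-1) ^+ 2.
    by apply: sumr_ge0 => v _; rewrite sqr_ge0.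
  have : 1 / p%:R ^+ 2 <= (p%:R - #|T|%:R) / p%:R ^+ 2 :> R.
    apply: ler_wpM2r; first by rewrite invr_ge0 exprn_ge0.
    by have := Tlt; rewrite -(ler_nat R) -natr1; lra.
  have : 0 <= (p%:R ^+ 2)^-1 :> R by rewrite invr_ge0 exprn_ge0.
  have -> : (4 * p%:R ^+ 2)^-1 = 4^-1 * (p%:R ^+ 2)^-1 :> R by field.
  by lra.
have {}Tp : #|T| = p by lia.
have [e [eT e3 eF]] : exists e : {set V}, [/\ e \subset T, #|e| = 3%N & e \notin F].
  case: (pickP [pred e : {set V} | [&& e \subset T, #|e| == 3%N & e \notin F]]).
    by move=> e /and3P[? /eqP ? ?]; exists e.
  move=> H; case: nK; exists T; split=> // e eT e3; have /= := H e.
  by rewrite eT e3 eqxx /= => /negbFE.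
have uF' : uniform3 (e |: F).
  by move=> f; rewrite !inE => /orP[/eqP->|/uF].
have Tle : (#|T| <= p)%N by rewrite Tp.
have := lam_le_variance p0 uF' x0 xT x1 Tle; rewrite lamU1 //.
have P0 : 0 <= \prod_(v in e) x v by apply: prodr_ge0.
(* Either a vertex of [e] weighs less than half of [1 / p], and its deviation alone gives the
   excess, or the product over [e] is at least [1 / (8 p^3)], and six times that exceeds the gap. *)
case: (pickP [pred v | (v \in e) && (x v < (2 * p%:R)^-1)]) => [a /andP[ae xa]|H].
  suff : (4 * p%:R ^+ 2)^-1 <= \sum_v x v ^+ 2 - p%:R^-1 by move/key; lra.
  rewrite Vq Tp subrr mul0r addr0 (bigD1 a) ?(subsetP eT) //=.
  set S := \sum_(v in T | v != a) _; have S0 : 0 <= S.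
    by apply: sumr_ge0 => v _; rewrite sqr_ge0.
  have -> : (4 * p%:R ^+ 2)^-1 = ((2 * p%:R)^-1) ^+ 2 :> R by field.
  have E : p%:R^-1 = 2 * (2 * p%:R)^-1 :> R by field.
  rewrite E; set q := (2 * p%:R)^-1 in xa *.
  have : 0 <= (q - x a) * (3 * q - x a).
    by have xa0 := x0 a; apply: mulr_ge0; lra.
  by lra.
have : \prod_(v in e) (2 * p%:R)^-1 <= \prod_(v in e) x v.
  apply: ler_prod => v ve; rewrite invr_ge0 mulr_ge0 //=.
  by have /= := H v; rewrite ve /= => /negbT; rewrite -leNgt.
rewrite prodr_const e3.
have -> : (2 * p%:R)^-1 ^+ 3 = 8^-1 * (p%:R ^+ 3)^-1 :> R by field.
have -> : (4 * p%:R ^+ 3)^-1 = 4^-1 * (p%:R ^+ 3)^-1 :> R by field.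
have : 0 <= (p%:R ^+ 3)^-1 :> R by rewrite invr_ge0 exprn_ge0.
have : 0 <= (1 - 4 / p%:R) * (\sum_v x v ^+ 2 - p%:R^-1).
  apply: mulr_ge0; first by rewrite subr_ge0 ler_pdivrMr; lra.
  rewrite Vq Tp subrr mul0r addr0.
  by apply: sumr_ge0 => v _; rewrite sqr_ge0.
lra.
Qed.

Lemma lam_le_dens F x T (p : nat) : (4 <= p)%N -> uniform3 F ->
  (forall v, 0 <= x v) -> (forall v, v \notin T -> x v = 0) ->
  \sum_v x v = 1 -> (#|T| <= p)%N -> 6 * lam F x <= dens p%:R.
Proof.
move=> p4 uF x0 xT x1 Tp.
have p0 : (0 < p)%N by lia.
have p4R : 4 <= p%:R :> R by rewrite (ler_nat R 4 p).
have := lam_le_variance p0 uF x0 xT x1 Tp.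
suff : 0 <= (1 - 4 / p%:R) * (\sum_v x v ^+ 2 - p%:R^-1) by lra.
apply: mulr_ge0; first by rewrite subr_ge0 ler_pdivrMr; lra.
rewrite (variance_eq p0 xT x1) addr_ge0 //.
  by apply: sumr_ge0 => v _; rewrite sqr_ge0.
by rewrite divr_ge0 ?exprn_ge0 // subr_ge0 ler_nat.
Qed.

(** * Effect of scaling, moving weight, compressing and deleting a vertex *)

Lemma eq_lam F x y : (forall e, e \in F -> {in e, x =1 y}) -> lam F x = lam F y.
Proof. by move=> xy; apply: eq_bigr => e /xy exy; apply: eq_bigr. Qed.

Lemma lam_scale F x (c : R) : uniform3 F ->
  lam F (fun v => c * x v) = c ^+ 3 * lam F x.
Proof.
move=> uF; rewrite /lam mulr_sumr; apply: eq_bigr => e eF.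
by rewrite big_split /= prodr_const uF.
Qed.

(** Rescaling [x] to total weight 1 keeps its zeros. Testing only weightings that vanish where [x]
    does admits bounds valid on a small support. *)
Lemma lam_homogeneous F x (B : R) : uniform3 F ->
  (forall y, (forall v, 0 <= y v) -> (forall v, x v = 0 -> y v = 0) ->
    \sum_v y v = 1 -> lam F y <= B) ->
  (forall v, 0 <= x v) -> lam F x <= B * (\sum_v x v) ^+ 3.
Proof.
move=> uF hB x0; set s := \sum_v x v.
have [s0|sn0] := eqVneq s 0.
  have xz v : x v = 0.
    move/eqP: s0; rewrite psumr_eq0 // => /allP /(_ v (mem_index_enum _)).
    by move/eqP.
  rewrite s0 expr0n mulr0 /lam big1 // => e eF.
  have : (0 < #|e|)%N by rewrite uF.
  by case/card_gt0P => v ve; rewrite (bigD1 v) //= xz mul0r.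
have sp : 0 < s by rewrite lt_neqAle eq_sym sn0 sumr_ge0.
have -> : lam F x = s ^+ 3 * lam F (fun v => s^-1 * x v).
  by rewrite lam_scale // mulrA -exprMn divff // expr1n mul1r.
rewrite [leRHS]mulrC; apply: ler_wpM2l; first by rewrite exprn_ge0 // ltW.
apply: hB => [v|v ->|]; rewrite ?mulr0 //.
  by rewrite mulr_ge0 // invr_ge0 ltW.
by rewrite -mulr_sumr mulVf.
Qed.

Definition move_weight (i j : V) x v :=
  if v == i then x i + x j else if v == j then 0 else x v.

(** No monomial contains both weights, so the polynomial is affine in the pair; the two sums are its
    partial derivatives in [x i] and [x j]. *)
Lemma lam_move F x i j : i != j ->
  (forall e, e \in F -> ~~ ((i \in e) && (j \in e))) ->
  lam F (move_weight i j x) - lam F x =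
  x j * (\sum_(e in F) (i \in e)%:R * \prod_(v in e :\ i) x v
         - \sum_(e in F) (j \in e)%:R * \prod_(v in e :\ j) x v).
Proof.
move=> ij nF; rewrite /lam -!sumrB mulr_sumr; apply: eq_bigr => e /nF.
have [ie|ie] := boolP (i \in e); have [je|je] := boolP (j \in e) => //= _.
- rewrite (big_setD1 i) // [X in _ - X](big_setD1 i) //= /move_weight eqxx.
  have -> : \prod_(v in e :\ i) (if v == i then x i + x j else
      if v == j then 0 else x v) = \prod_(v in e :\ i) x v.
    apply: eq_bigr => v; rewrite !inE => /andP[/negbTE-> ve].
    by case: eqP => // vj; rewrite -vj ve in je.
  ring.
- rewrite (big_setD1 j) // [X in _ - X](big_setD1 j) //=.
  by rewrite /move_weight eqxx eq_sym (negbTE ij); ring.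
- suff -> : \prod_(v in e) move_weight i j x v = \prod_(v in e) x v by ring.
  apply: eq_bigr => v ve; rewrite /move_weight.
  case: eqP => [vi|_]; first by rewrite -vi ve in ie.
  by case: eqP => // vj; rewrite -vj ve in je.
Qed.

Lemma move_weight_ge0 i j x : (forall v, 0 <= x v) ->
  forall v, 0 <= move_weight i j x v.
Proof.
by move=> x0 v; rewrite /move_weight; do 2?case: ifP => _; rewrite ?addr_ge0.
Qed.

Lemma sum_move_weight i j x : i != j ->
  \sum_v move_weight i j x v = \sum_v x v.
Proof.
move=> ij; have ji : j != i by rewrite eq_sym.
rewrite (bigD1 i) //= [RHS](bigD1 i) //= (bigD1 j) //= [in RHS](bigD1 j) //=.
rewrite /move_weight eqxx eq_sym (negbTE ij) eqxx add0r addrA; congr (_ + _).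
by apply: eq_bigr => v /andP[/negbTE-> /negbTE->].
Qed.

(* The polynomial is affine along the segment exchanging the weights of two
   vertices that lie in no common edge. *)
Lemma uncovered_pair F x i j : i != j -> (forall v, 0 <= x v) ->
  0 < x i -> 0 < x j -> (forall e, e \in F -> ~~ ((i \in e) && (j \in e))) ->
  exists y, [/\ forall v, 0 <= y v, \sum_v y v = \sum_v x v,
    [set v | 0 < y v] \proper [set v | 0 < x v] & lam F x <= lam F y].
Proof.
move=> ij x0 xi xj nF.
have supp a b : a != b -> 0 < x a -> 0 < x b ->
    [set v | 0 < move_weight a b x v] \proper [set v | 0 < x v].
  move=> ab xa xb; apply/properP; split.
    apply/subsetP => v; rewrite !inE /move_weight.
    by case: eqP => [->//|_]; case: eqP => // _; rewrite ltxx.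
  by exists b; rewrite !inE /move_weight // eq_sym (negbTE ab) eqxx ltxx.
have ji : j != i by rewrite eq_sym.
have nF' e : e \in F -> ~~ ((j \in e) && (i \in e)) by rewrite andbC; apply: nF.
have := lam_move x ij nF; have := lam_move x ji nF'.
set Di := \sum_(e in F) (i \in e)%:R * _; set Dj := \sum_(e in F) (j \in e)%:R * _.
move=> H1 H2; have [le|le] := lerP Dj Di.
  exists (move_weight i j x); split;
    [exact: move_weight_ge0|exact: sum_move_weight|exact: supp|].
  by rewrite -subr_ge0 H2 mulr_ge0 ?subr_ge0.
exists (move_weight j i x); split;
  [exact: move_weight_ge0|exact: sum_move_weight|exact: supp|].
by rewrite -subr_ge0 H1 mulr_ge0 ?subr_ge0 // ltW.
Qed.

(** Doubling the polynomial pairs every [e] with [swap i j e]. When exactly one set of a pair is an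
    edge, the shift keeps the one through [i], whose product is at least as large. *)
Lemma lam_shift F x i j : (forall v, 0 <= x v) -> x j <= x i ->
  lam F x <= lam (shift i j F) x.
Proof.
move=> x0 xji; pose w e := \prod_(v in e) x v.
have lamE F' : 2 * lam F' x = \sum_e ((e \in F')%:R * w e
    + (swap i j e \in F')%:R * w (swap i j e)).
  rewrite big_split /=.
  have E : lam F' x = \sum_e (e \in F')%:R * w e.
    rewrite /lam big_mkcond; apply: eq_bigr => e _.
    by case: (e \in F'); rewrite ?mul1r ?mul0r.
  have <- : \sum_e (e \in F')%:R * w e =
      \sum_e (swap i j e \in F')%:R * w (swap i j e).
    by rewrite (reindex_inj (@swap_inj _ i j)).
  by rewrite -E; ring.
rewrite -(ler_pM2l (ltr0n R 2)) !lamE; apply: ler_sum => e _.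
have main (f : {set V}) : i \in f -> j \notin f ->
   (f \in F)%:R * w f + (swap i j f \in F)%:R * w (swap i j f) <=
   (f \in shift i j F)%:R * w f
   + (swap i j f \in shift i j F)%:R * w (swap i j f).
  move=> fi fj; rewrite !inE !in_swap tpermL tpermR fi (negbTE fj) /= swapK.
  have : w (swap i j f) <= w f.
    rewrite /w big_imset /=; last by move=> ? ? _ _; apply: perm_inj.
    rewrite (big_setD1 i) // [leRHS](big_setD1 i) //= tpermL.
    have -> : \prod_(v in f :\ i) x (tperm i j v) = \prod_(v in f :\ i) x v.
      apply: eq_bigr => v; rewrite !inE => /andP[vi vf].
      by rewrite tpermD // eq_sym //; apply: contraNneq fj => <-.
    by apply: ler_wpM2r => //; apply: prodr_ge0.
  by case: (f \in F); case: (swap i j f \in F) => /=; lra.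
have [ei|ei] := boolP (i \in e); have [ej|ej] := boolP (j \in e).
- by rewrite swap_id ?ei ?ej // inE ei ej.
- exact: main.
- have := main (swap i j e); rewrite !in_swap tpermL tpermR swapK ej => /(_ isT ei).
  by rewrite addrC [leRHS]addrC.
- by rewrite swap_id ?(negbTE ei) ?(negbTE ej) // inE (negbTE ei) (negbTE ej).
Qed.

(** In an ordered edge through [m], that vertex takes one of three positions; letting the other two
    entries range freely over the remaining vertices, even coinciding, gives [(1 - x m) ^+ 2] each
    time. *)
Lemma lam_star F x m : uniform3 F -> (forall v, 0 <= x v) -> \sum_v x v = 1 ->
  6 * lam F x <= 3 * x m * (1 - x m) ^+ 2
                 + 6 * lam [set e in F | m \notin e] x.
Proof.
move=> uF x0 x1; set F' := [set e in F | _].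
have uF' : uniform3 F' by move=> e; rewrite inE => /andP[/uF].
rewrite !lam_ordered //.
(* [x] is split into its part [z] at [m] and its part [y] elsewhere. *)
pose y v := (v != m)%:R * x v; pose z v := (m == v)%:R * x v.
have y0 v : 0 <= y v by rewrite mulr_ge0.
have z0 v : 0 <= z v by rewrite mulr_ge0.
have sz : \sum_v z v = x m by rewrite /z sum_delta.
have sy : \sum_v y v = 1 - x m.
  rewrite -sz -x1 -sumrB; apply: eq_bigr => v _.
  by rewrite /y /z eq_sym; case: (m == v) => /=; ring.
have s3 (f g h : V -> R) : \sum_i \sum_j \sum_k f i * g j * h k =
    (\sum_v f v) * (\sum_v g v) * (\sum_v h v).
  under eq_bigr => i _.
    under eq_bigr => j _ do rewrite -mulr_sumr.
    rewrite -mulr_suml -mulr_sumr; over.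
  by rewrite -!mulr_suml.
have -> : 3 * x m * (1 - x m) ^+ 2 = \sum_i \sum_j \sum_k z i * y j * y k
   + \sum_i \sum_j \sum_k y i * z j * y k + \sum_i \sum_j \sum_k y i * y j * z k.
  by rewrite !s3 sz sy; ring.
rewrite -!big_split; apply: ler_sum => i _ /=.
rewrite -!big_split; apply: ler_sum => j _ /=.
rewrite -!big_split; apply: ler_sum => k _ /=.
have h1 : 0 <= z i * y j * y k by rewrite !mulr_ge0.
have h2 : 0 <= y i * z j * y k by rewrite !mulr_ge0.
have h3 : 0 <= y i * y j * z k by rewrite !mulr_ge0.
have h4 : 0 <= x i * x j * x k by rewrite !mulr_ge0.
rewrite /F' inE.
have [SF|_] := boolP (_ \in F); last by rewrite /= !mul0r; lra.
have [ij jk ik] := edge_distinct uF SF.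
have [mS|mS] := boolP (m \in _); last by rewrite /= mul1r; lra.
move: mS; rewrite !inE => /orP[/orP[]|] /eqP mE.
- have E : z i * y j * y k = x i * x j * x k.
    by rewrite /z /y mE eqxx (eq_sym j) (eq_sym k) ij ik /=; ring.
  by rewrite /= E mul1r mul0r; lra.
- have E : y i * z j * y k = x i * x j * x k.
    by rewrite /z /y mE eqxx (eq_sym k) ij jk /=; ring.
  by rewrite /= E mul1r mul0r; lra.
- have E : y i * y j * z k = x i * x j * x k.
    by rewrite /z /y mE eqxx jk ik /=; ring.
  by rewrite /= E mul1r mul0r; lra.
Qed.

(** Closes the induction step with [q = p - 3] and [a] the maximum weight. *)
Lemma star_density_gap (a q : R) : 0 <= a <= 1 -> 2 <= q ->
  3 * a * (1 - a) ^+ 2 + dens q * (1 - a) ^+ 3 <=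
  dens (q + 3) - (4 * (q + 3) ^+ 3)^-1.
Proof.
move=> /andP[a0 a1] q2; have q0 : q != 0 by apply/eqP; lra.
(* [k] is [(3 - dens q) / 2] in factored form. *)
set k := (2 * q - 1) * (q + 2) / (2 * q ^+ 2).
have k0 : 0 < k.
  by rewrite divr_gt0 ?mulr_gt0 ?exprn_gt0 //; lra.
(* the left-hand side is maximal at [1 - a = k^-1] *)
apply: (@le_trans _ _ (k ^- 2)).
  rewrite -(ler_pM2l (exprn_gt0 2 k0)) divff ?expf_neq0 ?gt_eqF //.
  have -> : 3 * a * (1 - a) ^+ 2 + dens q * (1 - a) ^+ 3 =
     3 * (1 - a) ^+ 2 - 2 * k * (1 - a) ^+ 3.
    by rewrite /dens /k; field.
  have u0 : 0 <= k * (1 - a) by rewrite mulr_ge0 ?subr_ge0 // ltW.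
  (* With [u = k * (1 - a)], this is the factorization of [1 - 3 u^2 + 2 u^3]. *)
  have : 0 <= (1 - k * (1 - a)) ^+ 2 * (1 + 2 * (k * (1 - a))).
    by rewrite mulr_ge0 ?sqr_ge0 //; lra.
  by lra.
(* In terms of [s = q - 2] the numerator of the difference has only positive coefficients. *)
rewrite /k; have [s s0 ->] : exists2 s, 0 <= s & q = s + 2 by exists (q - 2); lra.
rewrite -subr_ge0.
have -> : dens (s + 2 + 3) - (4 * (s + 2 + 3) ^+ 3)^-1
    - ((2 * (s + 2) - 1) * (s + 2 + 2) / (2 * (s + 2) ^+ 2)) ^- 2 =
  (36 * s ^+ 5 + 524 * s ^+ 4 + 2800 * s ^+ 3 + 6695 * s ^+ 2 + 6968 * s + 2416)
  / (4 * (s + 5) ^+ 3 * ((2 * s + 3) * (s + 4)) ^+ 2).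
  by rewrite /dens; field; rewrite ?mulf_neq0 ?andbT //; do ?(apply/andP; split);
    apply/eqP; lra.
apply: divr_ge0; last by rewrite !mulr_ge0 ?exprn_ge0 ?mulr_ge0 //; lra.
have [] : [/\ 0 <= s ^+ 2, 0 <= s ^+ 3, 0 <= s ^+ 4 & 0 <= s ^+ 5].
  by split; apply: exprn_ge0.
lra.
Qed.

End LagrangePolynomial.

(** * The gap for matching-free systems, by induction on the matching size *)

Section MatchingFreeBound.
Variables (R : realFieldType) (V : finType).
Implicit Types (F : {set {set V}}) (e T : {set V}) (x y : V -> R).

(** A matching of size [t] avoiding [m] covers at most [3 * t] vertices, so [T] has two further
    vertices [a], [b] besides [m], and [[set m; a; b]] extends the matching. *)
Lemma star_matching F T m t : uniform3 F -> (3 * t.+1 <= #|T|)%N ->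
  (forall a b, a \in T -> b \in T -> a != b -> a != m -> b != m ->
    [set m; a; b] \in F) ->
  has_matching [set e in F | m \notin e] t -> has_matching F t.+1.
Proof.
move=> uF cT star [M [sM tM cM]].
have sMF e : e \in M -> e \in F /\ m \notin e.
  by move/(subsetP sM); rewrite inE => /andP[].
have uM : uniform3 M by move=> e /sMF[/uF].
have cardM : (#|cover M| <= 3 * t)%N.
  apply: leq_trans (leq_card_cover M) _.
  by rewrite (eq_bigr (fun=> 3%N)) ?sum_nat_const ?cM 1?mulnC.
have : (1 < #|(T :\ m) :\: cover M|)%N.
  have := cardsD1 m T; have := cardsID (cover M) (T :\ m).
  have := subset_leq_card (subsetIr (T :\ m) (cover M)).
  by case: (m \in T) => /=; lia.
case/card_gt1P => a [b [aT bT ab]].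
move: aT bT; rewrite !inE => /andP[aM /andP[am aT]] /andP[bM /andP[bm bT]].
have eF := star a b aT bT ab am bm.
have mM : m \notin cover M by apply/bigcupP => -[e /sMF[_ /negbTE->]].
have [|tU cU] := @matchingU1 _ M [set m; a; b] uM tM.
  rewrite -setI_eq0; apply/eqP/setP => v; rewrite !inE.
  apply/negP => /andP[/orP[/orP[]|] /eqP ->]; exact/negP.
exists ([set m; a; b] |: M); split; rewrite ?cU ?cM //.
by rewrite subUset sub1set eF; apply/subsetP => e /sMF[].
Qed.

Lemma lam_support F x : (forall v, 0 <= x v) ->
  lam F x = lam [set e in F | e \subset [set v | 0 < x v]] x.
Proof.
move=> x0; rewrite /lam [RHS]big_mkcond /= big_mkcond; apply: eq_bigr => e _.
rewrite inE; case: (e \in F) => //=; case: ifPn => // /subsetPn[v ve].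
rewrite inE -leNgt => xv; rewrite (bigD1 v) //=.
by have /eqP -> : x v == 0; [rewrite eq_le xv x0|rewrite mul0r].
Qed.

(** Two nested inductions: the outer one on the support size, lowered by [uncovered_pair]; the inner
    one, with [x] and [m] fixed, on the number of edges avoiding [m], lowered by compression. *)
Lemma lam_gap t :
  (forall F x, uniform3 F -> ~ has_matching F t.+1 ->
    (forall v, 0 <= x v) -> \sum_v x v = 1 ->
    6 * lam F x <= dens (3 * t.+1 - 1)%:R) ->
  forall F x, uniform3 F -> ~ has_matching F t.+2 ->
    ~ contains_complete F (3 * t.+2 - 1) ->
    (forall v, 0 <= x v) -> \sum_v x v = 1 ->
    6 * lam F x <= dens (3 * t.+2 - 1)%:R - (4 * (3 * t.+2 - 1)%:R ^+ 3)^-1.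
Proof.
move=> IHt F x; set p := (3 * t.+2 - 1)%N.
have [n] := ubnP #|[set v | 0 < x v]|.
elim: n x F => // n IHn x F supp_n uF nM nK x0 x1.
set T := [set v | 0 < x v] in supp_n.
have xT v : v \notin T -> x v = 0.
  by rewrite inE -leNgt => xv; apply/eqP; rewrite eq_le xv x0.
have [v0 _] : exists v : V, true.
  case: (pickP (@predT V)) => [v _|E]; first by exists v.
  by move: x1; rewrite big_pred0 // => /esym/eqP; rewrite oner_eq0.
have [m xm] : exists m, forall v, x v <= x m.
  case: (@Order.TotalTheory.arg_maxP _ R V v0 predT x isT) => m _ H.
  by exists m => v; apply: H.
have mT : m \in T.
  rewrite inE lt_neqAle x0 andbT; apply/negP => /eqP m0.
  have : \sum_v x v = 0.
    by apply: big1 => v _; apply/eqP; rewrite eq_le x0 andbT m0.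
  by rewrite x1 => /eqP; rewrite oner_eq0.
have xm1 : x m <= 1 by rewrite -x1 (bigD1 m) //= lerDl sumr_ge0.
have [k] := ubnP #|[set e in F | m \notin e]|.
elim: k F uF nM nK => // k IHk F0 uF0 nM0 nK0 ltk.
(* Edges leaving the support contribute nothing; without them every vertex of an edge lies in [T],
   so the covering property applies to it. *)
rewrite lam_support // -/T; set F := [set e in F0 | _].
have sF : F \subset F0 by apply/subsetP => e; rewrite inE => /andP[].
have FT e : e \in F -> e \subset T by rewrite inE => /andP[].
have uF : uniform3 F by move=> e /(subsetP sF)/uF0.
have nM : ~ has_matching F t.+2 by move/(has_matchingS sF).
have nK : ~ contains_complete F p by move/(contains_completeS sF).
have {}ltk : (#|[set e in F | m \notin e]| < k.+1)%N.
  apply: leq_ltn_trans ltk; apply/subset_leq_card/subsetP => e.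
  by rewrite !inE => /andP[/andP[-> _] ->].
clearbody F.
case: (pickP [pred ij : V * V | [&& ij.1 \in T, ij.2 \in T, ij.1 != ij.2 &
    [forall e in F, ~~ ((ij.1 \in e) && (ij.2 \in e))]]]).
  move=> [i j] /and4P[/= iT jT ij /forall_inP nij].
  rewrite !inE in iT jT.
  have [y [y0 y1 suppy le]] := uncovered_pair ij x0 iT jT nij.
  apply: (@le_trans _ _ (6 * lam F y)); first by rewrite ler_pM2l.
  apply: IHn => //; last by rewrite y1.
  have := proper_card suppy; rewrite -/T; lia.
move=> cov0.
have cov i j : i \in T -> j \in T -> i != j ->
    exists2 e, e \in F & (i \in e) && (j \in e).
  move=> iT jT ij; have /= := cov0 (i, j); rewrite iT jT ij /= => /negbT.
  by case/forall_inPn => e eF; rewrite negbK; exists e.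
have [Tp|Tp] := leqP #|T| p.
  by apply: (@lam_small_gap _ _ F x T) => //; rewrite /p; lia.
case: (pickP [pred ce : V * {set V} | [&& ce.2 \in F, m \notin ce.2,
    ce.1 \in ce.2 & swap m ce.1 ce.2 \notin F]]).
  move=> [c e] /and4P[/= eF me ce sF'].
  have cT : c \in T by apply: subsetP (FT _ eF) _ ce.
  have mc : m != c by apply: contraNneq me => ->.
  (* This covering edge is what [shift_complete] needs to exclude a new complete subsystem. *)
  have [e0 e0F /andP[me0 ce0]] := cov m c mT cT mc.
  apply: (@le_trans _ _ (6 * lam (shift m c F) x)).
    by rewrite ler_pM2l ?lam_shift.
  apply: IHk.
  - exact: shift_uniform3.
  - by move/shift_matching.
  - by move/(shift_complete (isT : (0 < t.+2)%N) uF nM e0F me0 ce0 mc).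
  apply: (@leq_trans #|[set e in F | m \notin e]|) => //.
  apply: proper_card; apply/properP; split.
    apply/subsetP => f; rewrite [in X in X -> _]inE => /andP[fS mf].
    by rewrite inE mf andbT; case: (shift_notin mf fS).
  exists e; first by rewrite inE eF.
  rewrite inE me andbT; apply/negP => eS.
  by have [_] := shift_notin me eS; rewrite (negbTE sF').
move=> stable0.
have stable c e : e \in F -> m \notin e -> c \in e -> swap m c e \in F.
  move=> eF me ce; have /= := stable0 (c, e).
  by rewrite eF me ce /= => /negbFE.
(* Take an edge covering [a] and [b]; if it avoids [m], stability allows replacing its third vertex
   by [m]. *)
have star a b : a \in T -> b \in T -> a != b -> a != m -> b != m ->
    [set m; a; b] \in F.
  move=> aT bT ab am bm; have [e eF /andP[ae be]] := cov a b aT bT ab.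
  have c3 : #|[set m; a; b]| = 3%N.
    by rewrite -setUA !cardsU1 cards1 !inE negb_or ab 2!(eq_sym m) am bm.
  have [me|me] := boolP (m \in e).
    suff -> : [set m; a; b] = e by [].
    apply/eqP; rewrite eqEcard c3 uF // andbT.
    by apply/subsetP => v; rewrite !inE => /orP[/orP[]|] /eqP->.
  have : (0 < #|e :\ a :\ b|)%N.
    have := cardsD1 a e; have := cardsD1 b (e :\ a).
    by rewrite (uF e) // ae !inE be eq_sym ab /= !add1n => -> [<-].
  case/card_gt0P => c; rewrite !inE => /and3P[cb ca ce].
  suff -> : [set m; a; b] = swap m c e by apply: stable.
  apply/eqP; rewrite eqEcard c3 card_swap uF // andbT.
  apply/subsetP => v; rewrite !inE in_swap => /orP[/orP[]|] /eqP->.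
  - by rewrite tpermL.
  - by rewrite tpermD // eq_sym.
  - by rewrite tpermD // eq_sym.
have cT : (3 * t.+2 <= #|T|)%N by move: Tp; rewrite /p; lia.
have nM' : ~ has_matching [set e in F | m \notin e] t.+1.
  by move=> h; apply: nM; apply: star_matching cT star h.
apply: le_trans (lam_star m uF x0 x1) _.
set F' := [set e in F | m \notin e] in nM' *.
have uF' : uniform3 F' by move=> e; rewrite inE => /andP[/uF].
(* Edges avoiding [m] do not see its weight; zeroing it leaves total weight [1 - x m], to which the
   bound for smaller matchings applies by homogeneity. *)
pose y v := if v == m then 0 else x v.
have y0 v : 0 <= y v by rewrite /y; case: ifP.
have sy : \sum_v y v = 1 - x m.
  rewrite -x1 (bigD1 m) //= [in RHS](bigD1 m) //= /y eqxx add0r addrAC subrr add0r.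
  by apply: eq_bigr => v /negbTE->.
have -> : lam F' x = lam F' y.
  apply: eq_lam => e; rewrite inE => /andP[_ me] v ve; rewrite /y.
  by case: eqP => // vm; rewrite -vm ve in me.
have := @lam_homogeneous R V F' y (dens (3 * t.+1 - 1)%:R / 6) uF' _ y0.
rewrite sy => H.
have {}H : lam F' y <= dens (3 * t.+1 - 1)%:R / 6 * (1 - x m) ^+ 3.
  apply: H => z z0 _ z1; have := IHt F' z uF' nM' z0 z1; lra.
have := @star_density_gap R (x m) (3 * t.+1 - 1)%:R.
rewrite x0 xm1 (ler_nat R 2) => /(_ isT) G.
have {}G := G ltac:(lia).
have -> : p%:R = (3 * t.+1 - 1)%:R + 3 :> R.
  by rewrite -(natrD R _ 3); congr (_%:R); rewrite /p; lia.
lra.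
Qed.

Lemma dens_ge0 (p : nat) : (2 <= p)%N -> 0 <= dens p%:R :> R.
Proof.
move=> p2; have p2R : 2 <= p%:R :> R by rewrite (ler_nat R 2).
have -> : dens p%:R = (p%:R - 1) * (p%:R - 2) / p%:R ^+ 2 :> R.
  by rewrite /dens; field; apply/eqP; lra.
by rewrite divr_ge0 ?mulr_ge0 ?exprn_ge0 ?subr_ge0 //; lra.
Qed.

(** Supplies the hypothesis of [lam_gap] for every [t]. In the base case there are no edges; later,
    either [lam_gap] applies or all edges lie inside a complete [K], where [lam_le_dens]
    suffices. *)
Lemma lam_matching_free t F x : uniform3 F -> ~ has_matching F t.+1 ->
  (forall v, 0 <= x v) -> \sum_v x v = 1 ->
  6 * lam F x <= dens (3 * t.+1 - 1)%:R.
Proof.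
elim: t F x => [|t IHt] F x uF nM x0 x1.
  suff -> : F = set0.
    by rewrite /lam big_set0 mulr0; apply: dens_ge0.
  apply/setP => e; rewrite inE; apply/negP => eF; case: nM.
  exists [set e]; split; rewrite ?sub1set ?cards1 //.
  by apply/trivIsetP => A B; rewrite !inE => /eqP-> /eqP->; rewrite eqxx.
have [[K [cK hK]]|nK] := boolp.EM (contains_complete F (3 * t.+2 - 1)); last first.
  apply: le_trans (lam_gap IHt uF nM nK x0 x1) _.
  by rewrite gerBl invr_ge0 mulr_ge0 ?exprn_ge0.
(* Restricting to [K] may lower the total weight below 1, hence the detour through homogeneity. *)
pose y v := if v \in K then x v else 0.
have y0 v : 0 <= y v by rewrite /y; case: ifP.
have y1 : \sum_v y v <= 1.
  by rewrite -x1; apply: ler_sum => v _; rewrite /y; case: ifP.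
have -> : lam F x = lam F y.
  apply: eq_lam => e eF v ve; rewrite /y.
  by rewrite (subsetP (edge_sub_complete (isT : 0 < t.+2)%N uF nM cK hK eF)).
have H : lam F y <= dens (3 * t.+2 - 1)%:R / 6 * (\sum_v y v) ^+ 3.
  apply: lam_homogeneous => // z z0 zy z1.
  suff : 6 * lam F z <= dens (3 * t.+2 - 1)%:R by lra.
  apply: (@lam_le_dens _ _ F z K) => //; rewrite ?cK //; first by lia.
  by move=> v /negbTE vK; apply: zy; rewrite /y vK.
have : (\sum_v y v) ^+ 3 <= 1 by rewrite exprn_ile1 // sumr_ge0.
have : 0 <= dens (3 * t.+2 - 1)%:R :> R by apply: dens_ge0; lia.
move: H; set d := dens _; set s := _ ^+ 3; move=> H d0 s1.
by nra.
Qed.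

End MatchingFreeBound.

(** * Translation between set systems and [r_graph] *)

Lemma has_matching_copy (G : r_graph 3) t : (0 < t)%N ->
  has_matching (edges G) t -> contains_copy G (matching_rgraph 3 t).
Proof.
move=> t0 [M [/subsetP sM tM cM]].
have uM e : e \in M -> #|e| = 3%N by move/sM/edges_card.
have [v0 _] : exists v : vertex G, true.
  have : (0 < #|M|)%N by rewrite cM.
  case/card_gt0P => e /uM e3; have : (0 < #|e|)%N by rewrite e3.
  by case/card_gt0P => v; exists v.
(* Vertex [(i, j)] is sent to the [j]-th element of the [i]-th edge of [M]; the defaults [set0] and
   [v0] are never reached. *)
pose E (i : 'I_t) := nth set0 (enum M) i.
have EM i : E i \in M by rewrite -mem_enum mem_nth // -cardE cM.
have Einj i i' : E i = E i' -> i = i'.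
  move/eqP; rewrite nth_uniq -?cardE ?cM ?enum_uniq // => /eqP.
  exact: val_inj.
pose f (ij : 'I_t * 'I_3) := nth v0 (enum (E ij.1)) ij.2.
have fE i j : f (i, j) \in E i.
  by rewrite -mem_enum mem_nth // -cardE uM.
have finj : injective f.
  move=> [i j] [i' j'] eqf.
  have ii : i = i'.
    apply: Einj; apply/eqP/negPn/negP => ne.
    have := disjointFr (trivIsetP tM _ _ (EM i) (EM i') ne) (fE i j).
    by rewrite eqf fE.
  move: eqf; rewrite -ii /f /= => /eqP.
  by rewrite nth_uniq -?cardE ?uM ?enum_uniq // => /eqP /val_inj ->.
exists f; split=> // e /imsetP[i _ ->].
suff -> : f @: [set (i, j) | j in 'I_3] = E i by apply: sM.
apply/eqP; rewrite eqEcard uM // !card_imset ?card_ord //; last by move=> ? ? [].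
rewrite andbT; apply/subsetP => _ /imsetP[_ /imsetP[j _ ->] ->]; exact: fE.
Qed.

Lemma complete_iso (G : r_graph 3) t : (0 < t)%N ->
  ~ has_matching (edges G) t -> (forall v : vertex G, ~ isolated_vertex v) ->
  contains_complete (edges G) (3 * t - 1) ->
  rgraph_iso G (complete_rgraph 3 (3 * t - 1)).
Proof.
move=> t0 nM nI [K [cK hK]].
have uG : uniform3 (edges G) by move=> e; apply: edges_card.
have KT : K = [set: vertex G].
  apply/setP => v; rewrite inE; apply/negPn/negP => vK; apply: (nI v) => e eG.
  apply: contraNN vK.
  exact: (subsetP (edge_sub_complete t0 uG nM cK hK eG)).
have cV : #|vertex G| = (3 * t - 1)%N by rewrite -cardsT -KT.
have bij : bijective (fun v : vertex G => cast_ord cV (enum_rank v)).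
  exists (fun i => enum_val (cast_ord (esym cV) i)) => v.
    by rewrite cast_ordK enum_rankK.
  by rewrite enum_valK cast_ordKV.
exists (fun v => cast_ord cV (enum_rank v)); split=> // e.
rewrite inE card_imset; last exact: bij_inj.
apply/idP/eqP => [/uG//|e3]; apply: hK => //.
by rewrite KT subsetT.
Qed.

Lemma ffact3_dens (R : realFieldType) (p : nat) : (2 <= p)%N ->
  (p ^_ 3)%:R / p%:R ^+ 3 = dens p%:R :> R.
Proof.
case: p => [|[|p]] // _.
rewrite !ffactnS ffactn0 muln1 !natrM /= /dens -[p.+2]addn2 -[p.+1]addn1 !natrD.
have p0 : 0 <= p%:R :> R by [].
by field; apply/eqP; lra.
Qed.

(* Real Lagrangians and the conclusion *)
From mathcomp Require Import all_classical all_reals all_analysis.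

Lemma lagrangian_complete (R : realType) (p : nat) : (4 <= p)%N ->
  lagrangian R (complete_rgraph 3 p) = dens p%:R / 6.
Proof.
case: p => // p p4.
have [x [x0 x1] [<- xmax]] := @lagrangian_max R 3 (complete_rgraph 3 p.+1) ord0.
set E := edges (complete_rgraph 3 p.+1).
apply/eqP; rewrite eq_le; apply/andP; split.
  have uE : uniform3 E by move=> e; apply: edges_card.
  have := @lam_le_dens R _ E x [set: 'I_p.+1]%SET p.+1 p4 uE x0.
  rewrite cardsT card_ord /lam => /(_ _ x1 (leqnn _)) H.
  have {}H := H ltac:(by move=> v; rewrite inE).
  rewrite /lagrange_poly -/E; lra.
have pn0 : p.+1%:R != 0 :> R by rewrite pnatr_eq0.
(* The uniform weighting attains the upper bound. *)
apply: le_trans (xmax (fun=> p.+1%:R^-1) _); last first.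
  split=> [_|]; first by rewrite invr_ge0.
  by rewrite sumr_const -[LHS]mulr_natr card_ord mulVf.
rewrite /lagrange_poly (eq_bigr (fun=> p.+1%:R^-1 ^+ 3)); last first.
  by move=> e eE; rewrite prodr_const edges_card.
rewrite sumr_const -[leRHS]mulr_natl /= /complete_edges card_draws card_ord.
rewrite -ffact3_dens; last by lia.
rewrite -bin_ffact natrM exprVn.
have -> : 3`!%:R = 6 :> R by [].
rewrite le_eqVlt; apply/orP; left; apply/eqP; field.
by [].
Qed.

Theorem theorem3p3 (R : realType) (t : nat) (ht : (2 <= t)%N) :
  exists c1 : R, 0 < c1 /\
    forall G : r_graph 3,
      ~ contains_copy G (matching_rgraph 3 t) ->
      (forall v : vertex G, ~ isolated_vertex v) ->
      ~ rgraph_iso G (complete_rgraph 3 (3 * t - 1)) ->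
      lagrangian R G <= lagrangian R (complete_rgraph 3 (3 * t - 1)) - c1 /\
      lagrangian R (complete_rgraph 3 (3 * t - 1)) - c1 =
        1 / 6%:R * (((3 * t - 1) ^_ 3)%:R / (3 * t - 1)%:R ^+ 3 - 6%:R * c1).
Proof.
have p5 : (5 <= 3 * t - 1)%N by lia.
have p5R : 5 <= (3 * t - 1)%:R :> R by rewrite (ler_nat R 5).
(* One sixth of the gap in [lam_gap], which bounds six times the polynomial. *)
exists ((4 * (3 * t - 1)%:R ^+ 3)^-1 / 6).
split; first by rewrite divr_gt0 ?invr_gt0 ?mulr_gt0 ?exprn_gt0 //; lra.
move=> G nC nI nIso; rewrite lagrangian_complete; last by lia.
rewrite ffact3_dens; last by lia.
split; last by lra.
have nM : ~ has_matching (edges G) t.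
  by move=> h; apply: nC; apply: has_matching_copy h; lia.
have nK : ~ contains_complete (edges G) (3 * t - 1).
  by move=> h; apply: nIso; apply: complete_iso => //; lia.
have uG : uniform3 (edges G) by move=> e; apply: edges_card.
have [t' tE] : exists t', t = t'.+2 by exists t.-2; lia.
rewrite tE in nM nK p5R *.
case: (pickP (@predT (vertex G))) => [v _|V0].
  have [x [x0 x1] [<- _]] := @lagrangian_max R 3 G v.
  have := lam_gap (@lam_matching_free R (vertex G) t') uG nM nK x0 x1.
  rewrite /lam /lagrange_poly; lra.
(* Without vertices the simplex is empty and the supremum takes its default value 0; it remains to
   see that the claimed bound is nonnegative. *)
have -> : lagrangian R G = 0.
  rewrite /lagrangian [X in sup X](_ : _ = classical_sets.set0) ?sup0 //.
  apply/seteqP; split=> // y [x [_ x1] _]; move: x1.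
  by rewrite big_pred0 // => /esym/eqP; rewrite oner_eq0.
set p := (_ - 1)%:R in p5R *.
have -> : dens p / 6 - (4 * p ^+ 3)^-1 / 6 =
   (4 * (p - 1) * (p - 2) * p - 1) / (24 * p ^+ 3).
  by rewrite /dens; field; apply/eqP; lra.
have h : 0 <= (p - 5) * p by rewrite mulr_ge0 //; lra.
have h2 : 0 <= (p - 5) * p * p by rewrite mulr_ge0 //; lra.
by rewrite divr_ge0 ?mulr_ge0 ?exprn_ge0 //; nra.
Qed.
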